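(* (i) Let $M$ be a fusible module over a right duo ring $R$. Then $M$ is reduced. (ii) A regular fusible module over a commutative ring is reduced.
   Context: Rings are associative with identity; modules are unital right modules. A ring $R$ is right duo if $Ra\subseteq aR$ for every $a\in R$. Let $M$ be a right $R$-module. For $m\in M$, $ann_R(m)=\{r\in R: mr=0\}$. $T_R(M)=\{m\in M: ann_R(m)\neq 0\}$ is the set of torsion elements, $T_R^{\star}(M)=\{m\in M: ann_R(m)=0\}$ the set of torsion free elements, and $Zd(M)=\{r\in R: mr=0\text{ for some }0\neq m\in M\}$. An element of $M$ is fusible if it can be written as $x+y$ with $x\in T_R(M)$ and $y\in T_R^{\star}(M)$; $M$ is fusible if every nonzero element of $M$ is fusible. A nonzero $m\in M$ is regular fusible if there exists $r\in R-Zd(M)$ such that $mr$ is fusible; $M$ is a regular fusible module if every nonzero element of $M$ is regular fusible. $M$ is reduced if for every $m\in M$ and $r\in R$ with $mr=0$ one has $mR\cap Mr=0$, where $Mr=\{nr: n\in M\}$. *)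

(* Defs.v *)
From HB Require Import structures.
From mathcomp Require Import all_boot all_order all_algebra.
From mathcomp Require Import boolp classical_sets.
Set Implicit Arguments.
Unset Strict Implicit.
Unset Printing Implicit Defensive.
Import GRing.Theory.
Local Open Scope classical_set_scope.
Local Open Scope ring_scope.

(* A right R-module is a left module over the converse ring R^c.  Rings are
   associative with identity, the zero ring not being excluded (pzRingType). *)
Definition ract (R : pzRingType) (M : lmodType R^c) (m : M) (r : R) : M :=
  (r : R^c) *: m.

Notation "m *> r" := (ract m r)
  (at level 40, left associativity) : ring_scope.

(* The right action law; it would fail with R in place of R^c. *)
Lemma ractA (R : pzRingType) (M : lmodType R^c) (m : M) (r s : R) :
  (m *> r) *> s = m *> (r * s).
Proof. exact: scalerA. Qed.

Definition right_duo (R : pzRingType) : Prop :=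
  forall a : R, [set r * a | r in [set: R]] `<=` [set a * r | r in [set: R]].

Section RightModule.
Variables (R : pzRingType) (M : lmodType R^c).

Definition ann (m : M) : set R := [set r | m *> r = 0].

Definition torsion : set M := [set m | ann m <> [set 0]].

Definition torsion_free : set M := [set m | ann m = [set 0]].

Definition Zd : set R := [set r | exists2 m : M, m <> 0 & m *> r = 0].

Definition fusible_elt (m : M) : Prop :=
  exists x y : M, [/\ torsion x, torsion_free y & m = x + y].

Definition fusible : Prop := forall m : M, m <> 0 -> fusible_elt m.

Definition regular_fusible_elt (m : M) : Prop :=
  m <> 0 /\ exists2 r : R, (~` Zd) r & fusible_elt (m *> r).

Definition regular_fusible : Prop :=
  forall m : M, m <> 0 -> regular_fusible_elt m.

Definition reduced : Prop :=
  forall (m : M) (r : R), m *> r = 0 ->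
    [set m *> s | s in [set: R]] `&` [set n *> r | n in [set: M]] = [set 0].

End RightModule.

Arguments torsion {R} M.
Arguments torsion_free {R} M.
Arguments Zd {R} M.
Arguments fusible {R} M.
Arguments regular_fusible {R} M.
Arguments reduced {R} M.

(* Main.v *)
Require Import Defs.
From HB Require Import structures.
From mathcomp Require Import all_boot all_order all_algebra.
From mathcomp Require Import boolp classical_sets.
Import GRing.Theory.
Local Open Scope ring_scope.

(** Over a right duo ring, [M] is reduced as soon as no nonzero [n *> r] is
    killed by [r]: if [m *> r = 0], every [m *> s] is killed by [r], because
    [s * r] can be rewritten as [r * s'] ([reduced_of_square]).

    The key fact is that a fusible element is never of the form [n *> r] with
    [n *> r *> r = 0] ([not_fusible_square]).  Write [n *> r = x + y] with
    [x *> a = 0], [a != 0], and [y] torsion free.  Moving [a] to the left gives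
    [x *> (r * a) = 0], so the torsion free [y] is killed by [r * a] as well,
    whence [r * a = 0].  But then [n *> r], and with it [y], is killed by [a],
    a contradiction.

    For a fusible module this applies to every nonzero [n *> r].  In the regular
    fusible commutative case it is applied to [n *> t *> r], where [t], not a
    zero divisor on [M], makes [n *> r *> t] fusible. *)

Lemma ract0 (R : pzRingType) (M : lmodType R^c) (m : M) : m *> 0 = 0.
Proof. exact: scale0r. Qed.

Lemma ract0l (R : pzRingType) (M : lmodType R^c) (r : R) : (0 : M) *> r = 0.
Proof. exact: scaler0. Qed.

Lemma ractDl (R : pzRingType) (M : lmodType R^c) (m n : M) (r : R) :
  (m + n) *> r = m *> r + n *> r.
Proof. exact: scalerDr. Qed.

Lemma right_duoP (R : pzRingType) (s a : R) :
  right_duo R -> exists s', s * a = a * s'.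
Proof.
move=> duoR; have [|s' _ <-] := duoR a (s * a); first by exists s.
by exists s'.
Qed.

Lemma comm_right_duo (R : comPzRingType) : right_duo R.
Proof. by move=> a _ [s _ <-]; exists s; rewrite // mulrC. Qed.

Lemma torsionP (R : pzRingType) (M : lmodType R^c) (x : M) :
  torsion M x -> exists2 a : R, a <> 0 & x *> a = 0.
Proof.
move=> tx; apply: contrapT => no_a; apply: tx; apply/seteqP; split=> [a xa|_ ->].
  by apply: contrapT => a0; apply: no_a; exists a.
exact: ract0.
Qed.

Lemma torsion_free_eq0 (R : pzRingType) (M : lmodType R^c) (y : M) (a : R) :
  torsion_free M y -> y *> a = 0 -> a = 0.
Proof. by rewrite /torsion_free /= => fy ya; have : ann y a by []; rewrite fy. Qed.

(** If [a] kills the torsion part of a fusible decomposition of [n *> r], the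
    right duo condition lets [r * a] kill it too; comparing with the torsion
    free part forces first [r * a = 0], then [a = 0]. *)
Lemma not_fusible_square (R : pzRingType) (M : lmodType R^c) (n : M) (r : R) :
  right_duo R -> n *> r *> r = 0 -> ~ fusible_elt (n *> r).
Proof.
move=> duoR nrr [x [y [/torsionP [a a0 xa] fy def_nr]]].
have [r' def_ra] := right_duoP R r a duoR.
have ra0 : r * a = 0.
  apply: (torsion_free_eq0 R M y) => //.
  rewrite -[LHS]add0r -[X in X + _](_ : x *> (r * a) = 0).
    by rewrite -ractDl -def_nr -ractA nrr ract0l.
  by rewrite def_ra -ractA xa ract0l.
apply: a0; apply: (torsion_free_eq0 R M y) => //.
by rewrite -[LHS]add0r -xa -ractDl -def_nr ractA ra0 ract0.
Qed.

Lemma reduced_of_square (R : pzRingType) (M : lmodType R^c) :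
  right_duo R ->
  (forall (n : M) (r : R), n *> r *> r = 0 -> n *> r = 0) -> reduced M.
Proof.
move=> duoR sqM m r mr; apply/seteqP; split=> [z [[s _ def_z] [n _ def_n]]|_ ->].
  rewrite -def_n; apply: sqM; rewrite def_n -def_z ractA.
  by have [s' ->] := right_duoP R s r duoR; rewrite -ractA mr ract0l.
by split; [exists 0 => //; exact: ract0 | exists 0 => //; exact: ract0l].
Qed.

Theorem theorem4 :
  (forall (R : pzRingType) (M : lmodType R^c),
      right_duo R -> fusible M -> reduced M) /\
  (forall (R : comPzRingType) (M : lmodType R^c),
      regular_fusible M -> reduced M).
Proof.
split=> [R M duoR fusM|R M fusM].
  apply: reduced_of_square => // n r nrr; apply: contrapT => /fusM.
  exact: not_fusible_square.
have duoR := comm_right_duo R.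
apply: reduced_of_square => // n r nrr.
apply: contrapT => /fusM [_ [t _]].
(* Commuting [t] past [r] exhibits [n *> r *> t] as a multiple by [r]. *)
have actC (k : M) : k *> r *> t = k *> t *> r by rewrite !ractA mulrC.
rewrite actC; apply: not_fusible_square => //.
by rewrite -!actC nrr ract0l.
Qed.
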